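(* Let $q\in\mathbb C$ with $0<|q|<1$, $z\in\mathbb C\setminus\{0\}$, $x=\frac12(z+z^{-1})\neq0$, $a,b,c\in\mathbb C\setminus\{0\}$ and $t\in\mathbb C$, with $\frac1{ab},\frac1{ac},-abct\notin\{q^{-k}:k\in\mathbb N_0\}$. Then the continuous dual $q^{-1}$-Hahn polynomials $p_n(x;a,b,c|q^{-1})$ satisfy $$\sum_{n=0}^\infty\frac{t^n\,q^{3\binom n2}\,p_n(x;a,b,c|q^{-1})}{(q,\frac1{ab},\frac1{ac};q)_n}=(-abct;q)_\infty\;{}_2\phi_3\left(\frac za,\,\frac1{az};\ \frac1{ab},\,\frac1{ac},\,-abct;\ q,-at\right).$$
   Context: $\mathbb N_0=\{0,1,2,\dots\}$. $(a;q)_n=\prod_{j=0}^{n-1}(1-aq^j)$ for $n\in\mathbb N_0\cup\{\infty\}$, $(a_1,\dots,a_k;q)_n=\prod_i(a_i;q)_n$, and $${}_r\phi_s(a_1,\dots,a_r;b_1,\dots,b_s;q,w)=\sum_{k\ge0}\frac{(a_1,\dots,a_r;q)_k}{(q,b_1,\dots,b_s;q)_k}\left((-1)^kq^{\binom k2}\right)^{1+s-r}w^k .$$ The continuous dual $q^{-1}$-Hahn polynomials (continuous dual $q$-Hahn polynomials with $q$ replaced by $q^{-1}$), for $x=\frac12(z+z^{-1})$, are $$p_n(x;a,b,c|q^{-1})=q^{-2\binom n2}(abc)^n\left(\tfrac1{ab},\tfrac1{ac};q\right)_n\;{}_3\phi_2\left(q^{-n},\frac za,\frac1{az};\ \frac1{ab},\frac1{ac};\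 q,\frac{q^n}{bc}\right).$$ *)

(* Defs.v *)
From HB Require Import structures.
From mathcomp Require Import all_boot all_order all_algebra.
From mathcomp Require Import complex.
From mathcomp Require Import all_classical all_reals all_analysis.
From mathcomp Require Import ring.

Set Implicit Arguments.
Unset Strict Implicit.
Unset Printing Implicit Defensive.

Import Order.TTheory GRing.Theory Num.Theory.
Import numFieldNormedType.Exports.

Local Open Scope classical_set_scope.
Local Open Scope ring_scope.

(* The field R[i] of complex numbers, named as a numClosedFieldType so that the
   norm topology that mathcomp-analysis attaches to every numClosedFieldType is
   inferred on it (nothing is inferred on the bare type R[i]). *)
Definition Cplx (R : realType) : numClosedFieldType := R[i].

Section QSeries.
Variable R : realType.
Notation C := (Cplx R).
Implicit Types (q a b c x z w : C) (s t : seq C) (n k : nat).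

Definition qpoch a q n : C := \prod_(0 <= j < n) (1 - a * q ^+ j).

Definition qpoch_inf a q : C := limn (qpoch a q).

Definition qpochs s q n : C := \prod_(a <- s) qpoch a q n.

(* The exponent 1 + s - r is taken in int, so that no truncation occurs. *)
Definition qhyp_term s t q w k : C :=
  qpochs s q k / qpochs (q :: t) q k
  * ((-1) ^+ k * q ^+ 'C(k, 2)) ^ (1 + (size t)%:Z - (size s)%:Z) * w ^+ k.

Definition qhyp s t q w : C := limn (series (qhyp_term s t q w)).

(* The right-hand side of the definition of p_n(x; a, b, c | q^-1), in terms of
   the parameter z with x = (z + 1/z) / 2; the 3phi2 terminates, since all its
   terms of index k > n contain the factor (q^-n; q)_k = 0. *)
Definition cdqinvHahn_z q n z a b c : C :=
  q ^- (2 * 'C(n, 2)) * (a * b * c) ^+ n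
  * qpochs [:: 1 / (a * b); 1 / (a * c)] q n
  * qhyp [:: q ^- n; z / a; 1 / (a * z)] [:: 1 / (a * b); 1 / (a * c)]
      q (q ^+ n / (b * c)).

(* As a function of x: one solution z of x = (z + 1/z) / 2 is picked, and by
   cdqinvHahnE below the value does not depend on which. *)
Definition cdqinvHahn q n x a b c : C :=
  cdqinvHahn_z q n (x + sqrtC (x ^+ 2 - 1)) a b c.

Lemma cdqinvHahn_zV q n z a b c :
  cdqinvHahn_z q n z^-1 a b c = cdqinvHahn_z q n z a b c.
Proof.
have qpochsV : qpochs [:: q ^- n; z^-1 / a; 1 / (a * z^-1)] q
             = qpochs [:: q ^- n; z / a; 1 / (a * z)] q.
  apply/funext => k; rewrite /qpochs !big_cons !big_nil; congr (_ * _).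
  by rewrite mulrCA !div1r !invfM invrK !(mulrC a^-1).
by rewrite /cdqinvHahn_z /qhyp /qhyp_term qpochsV.
Qed.

Lemma cdqinvHahnE q n z a b c : z != 0 ->
  cdqinvHahn q n ((z + z^-1) / 2) a b c = cdqinvHahn_z q n z a b c.
Proof.
move=> z0; rewrite /cdqinvHahn; set x := (_ / 2).
have two0 : (2 : C) != 0 by rewrite pnatr_eq0.
have xE : x ^+ 2 - 1 = ((z - z^-1) / 2) ^+ 2 by rewrite /x; field.
have /orP[/eqP ->|/eqP ->] :
    (sqrtC (x ^+ 2 - 1) == (z - z^-1) / 2)
    || (sqrtC (x ^+ 2 - 1) == - ((z - z^-1) / 2)).
- by rewrite -eqf_sqr sqrtCK xE.
- by congr cdqinvHahn_z; rewrite /x; field.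
- rewrite -[RHS]cdqinvHahn_zV.
  by congr cdqinvHahn_z; rewrite /x; field.
Qed.

End QSeries.

(* Main.v *)
Require Import Defs.
From HB Require Import structures.
From mathcomp Require Import all_boot all_order all_algebra.
From mathcomp Require Import complex.
From mathcomp Require Import all_classical all_reals all_analysis.
From mathcomp Require Import ring zify.

(** Write A = 1/(ab), B = 1/(ac), u = abct, and expand every polynomial by its
    terminating 3phi2.  The only factors of the (n,k) summand that mix n and k
    are
      (q^-n;q)_k / (q;q)_n = (-1)^k q^(k(k-1)/2 - nk) / (q;q)_(n-k)
    and (q^n/(bc))^k, so the powers q^(nk) cancel.  With n = m + k the summand
    becomes
      h_k * (u q^k)^m q^(m(m-1)/2) / (q;q)_m,
      h_k = (z/a, 1/(az);q)_k / (q, A, B;q)_k * q^(k(k-1)) (-at)^k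
    ([generating_summand]).  For fixed k the sum over m is Euler's series
      E(v) = sum_m v^m q^(m(m-1)/2) / (q;q)_m = (-v;q)_oo    at v = u q^k,
    and (-u q^k;q)_oo = (-u;q)_oo / (-u;q)_k supplies the third denominator
    parameter of the 2phi3 and the infinite product in front of it.

    The left-hand side is thus a double series summed along antidiagonals.  Its
    partial sums are sum_k h_k E_(N-k)(u q^k), with E_M the partial sums of E,
    and Tannery's theorem (dominated convergence for series, [tannery]) passes
    to the limit N -> oo: |h_k| is summable, and |E_M(u q^k)| is bounded
    uniformly in M and k since |q^k| <= 1.  The required summability always
    comes from a ratio test in which the ratio of consecutive terms tends to 0,
    thanks to the powers of q ([ratio_dominated], [qhyp_dominated]).

    Euler's identity follows from E(v) = (1 + v) E(vq): iterating,
    E(v) = (-v;q)_n E(v q^n), and E(v q^n) -> 1, again by Tannery's theorem. *)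

Set Implicit Arguments.
Unset Strict Implicit.
Unset Printing Implicit Defensive.

Import Order.TTheory GRing.Theory Num.Theory.
Import numFieldNormedType.Exports.

Local Open Scope classical_set_scope.
Local Open Scope ring_scope.

(** * Dominated series of complex numbers *)

Section ComplexSeries.
Context (R : realType).
Notation C := (Cplx R).
Local Notation "r %:C" := (real_complex R r : C).

(** The majorant takes real values, so that the order completeness of [R] can
    be used on it; the norm of [C] itself takes values in [C]. *)
Definition dominated (u : nat -> C) (M : nat -> R) : Prop :=
  (forall n, `|u n| <= (M n)%:C) /\ cvgn (series M).

(** The topology of [C] is that of its own norm, whose values and radii lie in
    [C]; this turns a radius into a real number. *)
Lemma gt0_real_complex (e : C) : 0 < e -> exists2 r : R, 0 < r & e = r%:C.
Proof.
case: e => r i; rewrite ltcE /= => /andP[/eqP -> r0].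
by exists r.
Qed.

Lemma norm_real_complex (r : R) : `|r%:C| = `|r|%:C.
Proof. by rewrite normc_def /= expr0n /= addr0 sqrtr_sqr. Qed.

Lemma real_complex_real (r : R) : r%:C \is Num.real.
Proof. by rewrite realE !lecR; exact: num_real. Qed.

Lemma cvg_real_complex (u : nat -> R) (l : R) :
  u @ \oo --> l -> (fun n => (u n)%:C) @ \oo --> l%:C.
Proof.
move=> ul; apply/cvgrPdist_lt => _ /gt0_real_complex[e e0 ->].
move/cvgrPdist_lt: ul => /(_ e e0); apply: filterS => n.
by rewrite -rmorphB norm_real_complex ltcR.
Qed.

(** Completeness of [C] is obtained from that of [R]: the real and imaginary
    parts are dominated by the modulus, hence are absolutely convergent real
    series. *)
Lemma dominated_cvg u M : dominated u M -> cvgn (series u).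
Proof.
move=> [uM cM].
have part (f : C -> R) : (forall x : C, `|f x|%:C <= `|x|) ->
    cvgn (series (fun n => f (u n))).
  move=> fle; apply: normed_cvg; apply: (series_le_cvg _ _ _ cM) => n.
  - by rewrite normr_ge0.
  - by rewrite -lecR; apply: le_trans (uM n); exact: normr_ge0.
  - by rewrite -lecR; apply: le_trans (fle _) (uM n).
have cRe := part (@complex.Re R) (@normc_ge_Re R).
have normc_ge_Im (x : C) : `|complex.Im x|%:C <= `|x|.
  by rewrite normc_def lecR -sqrtr_sqr ler_wsqrtr // lerDr sqr_ge0.
have cIm := part _ normc_ge_Im.
have -> : series u = (fun n =>
    (series (fun n => complex.Re (u n)) n)%:C +
    'i%C * (series (fun n => complex.Im (u n)) n)%:C).
  apply/funext => n.
  rewrite /series /= !rmorph_sum mulr_sumr -big_split /=.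
  apply: eq_bigr => i _; exact: complexE.
apply: is_cvgD; first by apply/cvg_ex; eexists; exact: cvg_real_complex cRe.
apply: is_cvgM; first exact: is_cvg_cst.
by apply/cvg_ex; eexists; exact: cvg_real_complex cIm.
Qed.

Lemma dominated_ge0 u M n : dominated u M -> 0 <= M n.
Proof.
by move=> [uM _]; rewrite -lecR; apply: le_trans (uM n); exact: normr_ge0.
Qed.

Lemma dominated_series_le u M n :
  dominated u M -> `|series u n| <= (limn (series M))%:C.
Proof.
move=> uM; apply: le_trans (ler_norm_sum _ _ _) _.
apply: (@le_trans _ _ (series M n)%:C).
  by rewrite /series /= rmorph_sum /= ler_sum // => k _; case: uM.
rewrite lecR; apply: nondecreasing_cvgn_le; last by case: uM.
by apply: nondecreasing_series => k _ _; exact: dominated_ge0 uM.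
Qed.

Lemma cvg_series_pointwise (g : nat -> nat -> C) (h : nat -> C) (n : nat) :
  (forall k, g ^~ k @ \oo --> h k) ->
  (fun N => series (g N) n) @ \oo --> series h n.
Proof.
move=> gh; elim: n => [|n IHn].
  have -> : (fun N => series (g N) 0) = cst (series h 0).
    by apply/funext => N; rewrite /series /= !big_geq.
  exact: cvg_cst.
have -> : (fun N => series (g N) n.+1) = (fun N => series (g N) n) + g^~ n.
  by apply/funext => N; rewrite seriesSr.
rewrite [X in _ --> X](seriesSr h n).
exact: (cvgD IHn (gh n)).
Qed.

(** The bound is a closed condition: if `|h k| exceeded [M k], some [g N k]
    within the excess of [h k] would exceed it as well. *)
Lemma dominated_lim (g : nat -> nat -> C) (h : nat -> C) M :
  (forall N, dominated (g N) M) ->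
  (forall k, g ^~ k @ \oo --> h k) -> dominated h M.
Proof.
move=> gM gh; split=> [k|]; last by case: (gM 0%N).
rewrite real_leNgt ?normr_real //; last exact: real_complex_real.
apply/negP; rewrite -subr_gt0 => d0.
move/cvgrPdist_lt: (gh k) => /(_ _ d0)[N _ /(_ N (leqnn N))].
apply/negP; rewrite -real_leNgt ?realB ?normr_real //;
  last exact: real_complex_real.
rewrite lerBlDr; apply: le_trans (lerD (lexx _) ((gM N).1 k)).
by rewrite -{1}(subrK (g N k) (h k)) ler_normD.
Qed.

(** Tannery's theorem.  Beyond a rank K, all the series differ from their K-th
    partial sums by little, uniformly in N, because the tails of the majorant
    are small; and finitely many terms converge together.  Finite sums of
    length depending on N are covered by extending their terms by 0. *)
Lemma tannery (g : nat -> nat -> C) (h : nat -> C) M :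
  (forall N, dominated (g N) M) ->
  (forall k, g ^~ k @ \oo --> h k) ->
  (fun N => limn (series (g N))) @ \oo --> limn (series h).
Proof.
move=> gM gh.
have hM := dominated_lim gM gh.
apply/cvgrPdist_lt => _ /gt0_real_complex[e e0 ->].
(* The difference of the limits splits below into three quantities less
   than e / 7 and two tails less than 2 (e / 7). *)
have e7 : 0 < e / 7 by rewrite divr_gt0.
have e7C : 0 < (e / 7)%:C by rewrite ltcR.
have [K _ tailM] : exists2 K, True & forall n, (K <= n)%N ->
    \sum_(K <= k < n) M k < 2 * (e / 7).
  have cM : series M @ \oo --> limn (series M) by case: hM.
  move/cvgrPdist_lt: cM => /(_ _ e7)[K _ KP]; exists K => // n Kn.
  rewrite -sub_series_geq //.
  rewrite mulr_natl mulr2n.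
  apply: le_lt_trans (ltrD (KP n Kn) (KP K (leqnn K))).
  rewrite [`|_ - series M n|]distrC; apply: le_trans (ler_normD _ _).
  by rewrite addrA subrK ler_norm.
have tail u n : dominated u M -> (K <= n)%N ->
    `|series u n - series u K| <= (2 * (e / 7))%:C.
  move=> [uM _] Kn; rewrite sub_series_geq //.
  apply: le_trans (ler_norm_sum _ _ _) _.
  apply: (@le_trans _ _ (\sum_(K <= k < n) M k)%:C).
    by rewrite rmorph_sum /= ler_sum.
  by rewrite lecR ltW // tailM.
have cK := @cvg_series_pointwise g h K gh.
move/cvgrPdist_lt: cK => /(_ _ e7C); apply: filterS => N NK.
have near_lim u : dominated u M -> exists2 n0, True & forall n, (n0 <= n)%N ->
    `|limn (series u) - series u n| < (e / 7)%:C.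
  move=> uM; have cu : series u @ \oo --> limn (series u) := dominated_cvg uM.
  by move/cvgrPdist_lt: cu => /(_ _ e7C)[n0 _ Hn0]; exists n0.
have [n1 _ Hh] := near_lim _ hM; have [n2 _ Hg] := near_lim _ (gM N).
pose n := maxn K (maxn n1 n2).
have Kn : (K <= n)%N by rewrite leq_maxl.
have {}Hh : `|limn (series h) - series h n| < (e / 7)%:C.
  by apply: Hh; rewrite !leq_max leqnn !orbT.
have {}Hg : `|limn (series (g N)) - series (g N) n| < (e / 7)%:C.
  by apply: Hg; rewrite !leq_max leqnn !orbT.
have -> : limn (series h) - limn (series (g N)) =
    (limn (series h) - series h n) + (series h n - series h K)
    + (series h K - series (g N) K) - (series (g N) n - series (g N) K)
    - (limn (series (g N)) - series (g N) n) by ring.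
have -> : e%:C = (e / 7)%:C + (2 * (e / 7))%:C + (e / 7)%:C
    + (2 * (e / 7))%:C + (e / 7)%:C.
  have {1}-> : e = e / 7 + 2 * (e / 7) + e / 7 + 2 * (e / 7) + e / 7 by field.
  by rewrite !(rmorphD (real_complex R)).
apply: le_lt_trans (ler_normB _ _) _; apply: ltrD Hg.
apply: le_lt_trans (ler_normB _ _) _; apply: ltr_leD (tail _ _ (gM N) Kn).
apply: le_lt_trans (ler_normD _ _) _; apply: ltrD NK.
apply: le_lt_trans (ler_normD _ _) _; apply: ltr_leD (tail _ _ hM Kn).
exact: Hh.
Qed.

Lemma cvg_expr_lt1 (q : C) : `|q| < 1 -> (fun n => q ^+ n) @ \oo --> (0 : C).
Proof.
move=> q1; have [r r1 rE] : exists2 r : R, `|r| < 1 & `|q| = r%:C.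
  exists (complex.Re `|q|); last by rewrite RRe_real // normr_real.
  by rewrite -ltcR -norm_real_complex RRe_real ?normr_real // normr_id.
apply/cvgrPdist_lt => _ /gt0_real_complex[e e0 ->].
have /cvgrPdist_lt/(_ _ e0) := cvg_expr r1.
apply: filterS => n; rewrite !sub0r !normrN !normrX rE -rmorphXn.
by rewrite ltcR -normrX; apply: le_lt_trans; exact: ler_norm.
Qed.

(** Past a rank K the ratio is at most 1/2, so the terms are at most
    D / 2^n once D absorbs the first K + 1 of them.  The recurrence is stated
    without division, since the terms may vanish. *)
Lemma ratio_dominated (u rho : nat -> C) :
  (forall n, u n.+1 = u n * rho n) -> rho @ \oo --> (0 : C) ->
  exists M, dominated u M.
Proof.
move=> uE /cvgrPdist_lt/(_ (2^-1)%:C) [|K _ rhoK];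
  first by rewrite ltcR invr_gt0.
have normE n : `|u n| = (complex.Re `|u n|)%:C by rewrite RRe_real ?normr_real.
pose D := \sum_(0 <= k < K.+1) complex.Re `|u k| * 2 ^+ k.
have Re_ge0 k : 0 <= complex.Re `|u k| by rewrite -lecR -normE normr_ge0.
exists (geometric D 2^-1); split; last first.
  by apply: is_cvg_geometric_series;
    rewrite ger0_norm ?invf_lt1 ?ltr1n ?invr_ge0.
have small n : (n <= K)%N -> complex.Re `|u n| <= geometric D 2^-1 n.
  move=> nK; rewrite /= exprVn ler_pdivlMr ?exprn_gt0 //.
  rewrite /D (bigD1_seq n) ?mem_index_iota ?iota_uniq //=.
  by rewrite lerDl sumr_ge0 // => i _;
    rewrite mulr_ge0 ?Re_ge0 ?exprn_ge0 ?ler0n.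
move=> n; rewrite normE lecR.
elim: n => [|n IHn]; first exact: small.
have [/small //|Kn] := leqP n.+1 K.
rewrite /= exprSr mulrA -lecR -normE uE normrM normE rmorphM /=.
apply: ler_pM; [by rewrite -normE normr_ge0|exact: normr_ge0|by rewrite lecR|].
by have := rhoK n Kn; rewrite sub0r normrN => /ltW.
Qed.
Lemma series_finite_support (u : nat -> C) n :
  (forall k, (n <= k)%N -> u k = 0) -> limn (series u) = series u n.
Proof.
move=> u0; apply: norm_lim_near_cst; exists n => // m /= nm.
apply/eqP; rewrite -subr_eq0 sub_series_geq //.
by rewrite big_nat_cond big1 // => k /andP[/andP[/u0]].
Qed.

(** [p] agrees with l / e as soon as [e] is nonzero, that is, eventually. *)
Lemma cvg_cofactor (p e : nat -> C) (l : C) :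
  (forall n, l = p n * e n) -> e @ \oo --> (1 : C) -> p @ \oo --> l.
Proof.
move=> lE e1.
have quot_cvg : (fun n => l / e n) @ \oo --> l.
  have -> : nbhs l = nbhs (l * 1^-1) by rewrite invr1 mulr1.
  exact: cvgM (cvg_cst l) (cvgV (oner_neq0 _) e1).
have quotE : \forall n \near \oo, l / e n = p n.
  move/cvgrPdist_lt: e1 => /(_ _ ltr01); apply: filterS => n en.
  rewrite {1}(lE n) mulfK //.
  by apply: contraTneq en => ->; rewrite subr0 normr1 ltxx.
exact: cvg_trans (near_eq_cvg quotE) quot_cvg.
Qed.

End ComplexSeries.

(** * q-shifted factorials and basic hypergeometric series *)

Section QPochhammer.
Context (R : realType).
Notation C := (Cplx R).
Implicit Types (q a v w : C) (s : seq C).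

Lemma qpoch0 a q : qpoch a q 0 = 1.
Proof. exact: big_geq. Qed.

Lemma qpochS a q n : qpoch a q n.+1 = qpoch a q n * (1 - a * q ^+ n).
Proof. by rewrite /qpoch big_nat_recr. Qed.

Lemma qpoch_factor_neq0 a q n : q != 0 -> a != q ^- n -> 1 - a * q ^+ n != 0.
Proof.
move=> q0; apply: contraNneq => /eqP; rewrite subr_eq0 eq_sym => /eqP aq1.
by rewrite -(mulfK (expf_neq0 n q0) a) aq1 mul1r.
Qed.

Lemma qpoch_neq0 a q n : q != 0 -> (forall k, a != q ^- k) -> qpoch a q n != 0.
Proof.
move=> q0 aq; rewrite /qpoch prodf_seq_neq0; apply/allP => k _ /=.
exact: qpoch_factor_neq0.
Qed.

(** This instantiates the hypothesis of [qpoch_neq0] for (q;q)_n. *)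
Lemma base_neq_expVn q k : q != 0 -> `|q| < 1 -> q != q ^- k.
Proof.
move=> q0 q1; apply: contraTneq q1 => qE.
have : q ^+ k.+1 = 1 by rewrite exprS {1}qE mulVf // expf_neq0.
move/(congr1 Num.norm); rewrite normrX normr1 => q1.
apply/negP => /(exprn_ilt1 k.+1 (normr_ge0 q)).
by rewrite q1 ltxx.
Qed.

Lemma qpochsS s q n :
  qpochs s q n.+1 = qpochs s q n * \prod_(a <- s) (1 - a * q ^+ n).
Proof.
by rewrite /qpochs -big_split; apply: eq_bigr => a _; rewrite qpochS.
Qed.

Lemma cvg_qpoch_factor a q : `|q| < 1 ->
  (fun n => 1 - a * q ^+ n) @ \oo --> (1 : C).
Proof.
move=> q1.
have := cvgB (cvg_cst (1 : C)) (cvgM (cvg_cst a) (cvg_expr_lt1 q1)).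
rewrite mulr0 subr0; exact.
Qed.

Lemma cvg_qpochs_factor s q : `|q| < 1 ->
  (fun n => \prod_(a <- s) (1 - a * q ^+ n)) @ \oo --> (1 : C).
Proof.
move=> q1; elim: s => [|a s IHs].
  by under eq_fun do rewrite big_nil; exact: cvg_cst.
under eq_fun do rewrite big_cons.
by have := cvgM (cvg_qpoch_factor a q1) IHs; rewrite mulr1; exact.
Qed.

Lemma bin2S n : 'C(n.+1, 2) = ('C(n, 2) + n)%N.
Proof. by rewrite binS bin1. Qed.

Lemma bin2D m k : 'C(m + k, 2) = ('C(m, 2) + 'C(k, 2) + m * k)%N.
Proof.
by elim: k => [|k IHk]; rewrite ?addn0 ?muln0 ?addnS ?bin2S ?IHk /=; lia.
Qed.

Lemma sign_sqr k : ((-1) ^+ k) ^+ 2 = 1 :> C.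
Proof. by rewrite -exprM mulnC exprM sqrrN !expr1n. Qed.

(** The ratio of consecutive terms is a quotient of products tending to 1,
    times w (- q^k)^(p+1), which tends to 0 because the exponent p + 1 of the
    factor (-1)^k q^(k(k-1)/2) is positive. *)
Lemma qhyp_dominated s t q w p : q != 0 -> `|q| < 1 ->
  (forall b k, b \in t -> b != q ^- k) -> size t = (size s + p)%N ->
  exists M, dominated (qhyp_term s t q w) M.
Proof.
move=> q0 q1 tq st.
have pE : 1 + (size t)%:Z - (size s)%:Z = p.+1 by rewrite st; lia.
pose rho k := (\prod_(a <- s) (1 - a * q ^+ k)
  / \prod_(b <- q :: t) (1 - b * q ^+ k)) * (- q ^+ k) ^+ p.+1 * w.
apply: (@ratio_dominated R _ rho) => [k|].
  rewrite /qhyp_term /rho pE -!exprnP !qpochsS bin2S exprD invfM.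
  have -> : (-1) ^+ k.+1 * (q ^+ 'C(k, 2) * q ^+ k)
      = ((-1) ^+ k * q ^+ 'C(k, 2)) * - q ^+ k by rewrite exprS; ring.
  by rewrite exprMn (exprS w); ring.
have cq : (fun k => (- q ^+ k) ^+ p.+1) @ \oo --> (0 : C).
  have cq1 : (fun k => - q ^+ k) @ \oo --> (0 : C).
    by have := cvgN (cvg_expr_lt1 q1); rewrite oppr0; exact.
  elim: p {pE st rho} => [|p IHp]; first by under eq_fun do rewrite expr1.
  under eq_fun do rewrite exprS.
  by have := cvgM cq1 IHp; rewrite mulr0; exact.
have := cvgM (cvgM (cvgM (cvg_qpochs_factor s q1)
  (cvgV (oner_neq0 _) (cvg_qpochs_factor (q :: t) q1))) cq) (cvg_cst w).
by rewrite mulr0 mul0r; exact.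
Qed.

End QPochhammer.

(** * Euler's product formula *)

Section Euler.
Context (R : realType).
Notation C := (Cplx R).
Variable q : C.
Hypotheses (q0 : q != 0) (q1 : `|q| < 1).
Implicit Types (v : C).

(** The general term of 0phi0(;; q, -v), Euler's series for (-v;q)_oo. *)
Definition euler_term v m : C := v ^+ m * q ^+ 'C(m, 2) / qpoch q q m.

Lemma qpoch_qq_neq0 n : qpoch q q n != 0.
Proof. by apply: qpoch_neq0 => // k; exact: base_neq_expVn. Qed.

Lemma qpoch_qq_factor_neq0 n : 1 - q * q ^+ n != 0.
Proof. by apply: qpoch_factor_neq0 => //; exact: base_neq_expVn. Qed.

Lemma euler_termS v m :
  euler_term v m.+1 = euler_term v m * (v * q ^+ m / (1 - q * q ^+ m)).
Proof.
rewrite /euler_term exprS bin2S exprD qpochS.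
by field; rewrite qpoch_qq_neq0 qpoch_qq_factor_neq0.
Qed.

Lemma euler_term_scale v m n :
  euler_term (v * q ^+ n) m = euler_term v m * q ^+ (n * m).
Proof. by rewrite /euler_term exprMn exprM; ring. Qed.

(** A single majorant serves all the arguments v q^n; this uniformity in n is
    what both uses of [tannery] rest on. *)
Lemma euler_dominated_scale v M n :
  dominated (euler_term v) M -> dominated (euler_term (v * q ^+ n)) M.
Proof.
move=> [vM cM]; split=> // m; rewrite euler_term_scale normrM normrX.
apply: le_trans (vM m); rewrite ler_piMr ?normr_ge0 //.
by rewrite exprn_ile1 // ltW.
Qed.

Lemma euler_dominated v : exists M, dominated (euler_term v) M.
Proof.
apply: (ratio_dominated (euler_termS v)).
have := cvgM (cvgM (cvg_cst v) (cvg_expr_lt1 q1))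
  (cvgV (oner_neq0 _) (cvg_qpoch_factor q q1)).
rewrite mulr0 mul0r; exact.
Qed.

Definition euler v : C := limn (series (euler_term v)).

Lemma cvg_euler v : series (euler_term v) @ \oo --> euler v.
Proof. by have [M /dominated_cvg] := euler_dominated v. Qed.

(** Termwise, e_(m+1)(v) - e_(m+1)(vq) = e_(m+1)(v) (1 - q^(m+1)), and the last
    factor cancels the last one of (q;q)_(m+1), leaving v e_m(vq). *)
Lemma euler_rec v : euler v = (1 + v) * euler (v * q).
Proof.
have step m : euler_term v m.+1 =
    euler_term (v * q) m.+1 + v * euler_term (v * q) m.
  have := euler_term_scale v ^~ 1%N; rewrite expr1 => scale.
  rewrite !scale !mul1n euler_termS exprS.
  by field; rewrite qpoch_qq_factor_neq0.
have stepS n : series (euler_term v) n.+1 =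
    series (euler_term (v * q)) n.+1 + v * series (euler_term (v * q)) n.
  elim: n => [|n IHn].
    by rewrite /series /= !big_nat1 big_geq // /euler_term !expr0 mulr0 addr0.
  rewrite seriesSr IHn step (seriesSr _ n.+1) (seriesSr (euler_term (v * q)) n).
  by ring.
have cS w : (fun n => series (euler_term w) n.+1) @ \oo --> euler w.
  by rewrite (cvg_shiftS (series (euler_term w))); exact: cvg_euler.
have rhs : (fun n => series (euler_term v) n.+1) @ \oo
    --> (1 + v) * euler (v * q).
  rewrite mulrDl mul1r; under eq_fun do rewrite stepS.
  exact: cvgD (cS (v * q)) (cvgM (cvg_cst v) (@cvg_euler (v * q))).
by rewrite -(norm_cvg_lim (cS v)); exact: norm_cvg_lim rhs.
Qed.

Lemma euler_qpoch v n : euler v = qpoch (- v) q n * euler (v * q ^+ n).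
Proof.
elim: n => [|n IHn]; first by rewrite qpoch0 expr0 mulr1 mul1r.
rewrite IHn (euler_rec (v * q ^+ n)) qpochS mulNr opprK mulrA exprSr (mulrA v).
reflexivity.
Qed.

(** Continuity of Euler's series at 0 along the points v q^n: only the term of
    index 0 survives in the limit. *)
Lemma cvg_euler_shift v : (fun n => euler (v * q ^+ n)) @ \oo --> (1 : C).
Proof.
have [M vM] := euler_dominated v.
have := @tannery R (fun n => euler_term (v * q ^+ n))
  (fun m => (m == 0%N)%:R) M.
have -> : limn (series (fun m => (m == 0%N)%:R : C)) = 1.
  apply: norm_lim_near_cst; exists 1%N => // -[//|n] _ /=.
  by rewrite /series /= big_nat_recl //= big1 ?addr0.
apply.
- by move=> n; exact: euler_dominated_scale.
- move=> m; under eq_fun do rewrite euler_term_scale.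
  case: m => [|m].
    under eq_fun do rewrite muln0 expr0 mulr1.
    by rewrite /euler_term expr0 qpoch0 divr1 mulr1; exact: cvg_cst.
  have qm1 : `|q ^+ m.+1| < 1 by rewrite normrX exprn_ilt1.
  under eq_fun do rewrite mulnC exprM.
  have := cvgM (cvg_cst (euler_term v m.+1)) (cvg_expr_lt1 qm1).
  rewrite mulr0; exact.
Qed.

(** Euler's identity: in E(v) = (-v;q)_n E(v q^n) the second factor tends
    to 1.  This also proves that the infinite product converges. *)
Lemma qpoch_inf_euler v : qpoch_inf (- v) q = euler v.
Proof.
apply: norm_cvg_lim.
have cE := @cvg_euler_shift v.
exact: cvg_cofactor (euler_qpoch v) cE.
Qed.

Lemma qpoch_inf_split v n :
  qpoch_inf (- v) q = qpoch (- v) q n * euler (v * q ^+ n).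
Proof. by rewrite qpoch_inf_euler (euler_qpoch v n). Qed.

End Euler.

(** * The expansion of the generating function *)

Lemma sum_antidiagonal (V : nmodType) (F : nat -> nat -> V) N :
  \sum_(0 <= n < N) \sum_(0 <= k < n.+1) F k (n - k)%N
  = \sum_(0 <= k < N) \sum_(0 <= m < N - k) F k m.
Proof.
elim: N => [|N IHN]; first by rewrite !big_geq.
rewrite big_nat_recr //= IHN [RHS]big_nat_recr //= subSnn big_nat1.
rewrite [X in _ + X]big_nat_recr //= subnn addrA -big_split /=.
congr (_ + _); apply: eq_big_nat => k /andP[_ kN].
by rewrite (subSn (ltnW kN)) (big_nat_recr (N - k)).
Qed.

Section GeneratingFunction.
Context (R : realType).
Notation C := (Cplx R).

Variable q : C.
Hypotheses (q0 : q != 0) (q1 : `|q| < 1).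

Lemma qpoch_expVn_eq0 n k : (n < k)%N -> qpoch (q ^- n) q k = 0.
Proof.
move=> nk; apply/eqP; rewrite /qpoch prodf_seq_eq0; apply/hasP.
by exists n; rewrite ?mem_index_iota //= mulVf ?subrr // expf_neq0.
Qed.

(** The division-free form of
    (q^-n;q)_k / (q;q)_n = (-1)^k q^(k(k-1)/2 - nk) / (q;q)_(n-k) at n = m + k.
    Induction on k with n fixed: passing from (k, m+1) to (k+1, m) multiplies
    the left-hand side by 1 - q^-(m+1) = - q^-(m+1) (1 - q^(m+1)) and removes
    the factor 1 - q^(m+1) from (q;q)_(m+1). *)
Lemma qpoch_expVn k m :
  qpoch (q ^- (m + k)) q k * qpoch q q m
  = (-1) ^+ k * q ^+ 'C(k, 2) * q ^- ((m + k) * k) * qpoch q q (m + k).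
Proof.
elim: k m => [|k IHk] m.
  by rewrite addn0 muln0 !qpoch0 !expr0 invr1 !mul1r.
have factor : (1 - q ^- (m + k.+1) * q ^+ k) * qpoch q q m =
    - q ^- m.+1 * qpoch q q m.+1.
  rewrite qpochS addnS -addSn exprD exprS; field.
  by rewrite !expf_neq0 // q0.
rewrite qpochS -mulrA factor addnS -addSn mulrCA IHk bin2S.
have -> : ((m.+1 + k) * k.+1 = (m.+1 + k) * k + m.+1 + k)%N by lia.
set n := ((m.+1 + k) * k)%N; rewrite (exprS (-1)) !(exprD q).
by field; rewrite !expf_neq0 // q0.
Qed.

Variables (z a b c t : C).
Hypotheses (a0 : a != 0) (b0 : b != 0) (c0 : c != 0).
Hypothesis hab : forall k : nat, 1 / (a * b) != q ^- k.
Hypothesis hac : forall k : nat, 1 / (a * c) != q ^- k.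

Let u : C := a * b * c * t.

(** The part of the double summand that depends on k alone; dividing it by
    (-abct;q)_k gives the general term of the 2phi3, see [hahn_coefE]. *)
Definition hahn_coef k : C :=
  qpochs [:: z / a; 1 / (a * z)] q k
  / qpochs [:: q; 1 / (a * b); 1 / (a * c)] q k
  * (q ^+ 'C(k, 2)) ^+ 2 * (- (a * t)) ^+ k.

Lemma cdqinvHahn_zE n : cdqinvHahn_z q n z a b c =
  q ^- (2 * 'C(n, 2)) * (a * b * c) ^+ n
  * qpochs [:: 1 / (a * b); 1 / (a * c)] q n
  * \sum_(0 <= k < n.+1)
      qpochs [:: q ^- n; z / a; 1 / (a * z)] q k
      / qpochs [:: q; 1 / (a * b); 1 / (a * c)] q k * (q ^+ n / (b * c)) ^+ k.
Proof.
rewrite /cdqinvHahn_z /qhyp (@series_finite_support R _ n.+1) => [|k nk].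
  by congr (_ * _); apply: eq_bigr => k _; rewrite /qhyp_term /= mulr1.
by rewrite /qhyp_term {1}/qpochs big_cons qpoch_expVn_eq0 // !mul0r.
Qed.

(** The powers q^(nk) of the argument q^n/(bc) and of [qpoch_expVn] cancel; of
    q^(3 n(n-1)/2) and the normalisation q^(-n(n-1)) there remains
    q^(n(n-1)/2), which splits by [bin2D] into a factor for m, one for k, and
    the power q^(mk) that shifts the argument u of Euler's series. *)
Lemma generating_summand m k (n := (m + k)%N) :
  t ^+ n * q ^+ (3 * 'C(n, 2))
  * (q ^- (2 * 'C(n, 2)) * (a * b * c) ^+ n
  * qpochs [:: 1 / (a * b); 1 / (a * c)] q n
  * (qpochs [:: q ^- n; z / a; 1 / (a * z)] q k
      / qpochs [:: q; 1 / (a * b); 1 / (a * c)] q k * (q ^+ n / (b * c)) ^+ k))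
  / qpochs [:: q; 1 / (a * b); 1 / (a * c)] q n
  = hahn_coef k * euler_term q (u * q ^+ k) m.
Proof.
have qq := qpoch_qq_neq0 q0 q1.
have expVnE : qpoch (q ^- n) q k = (-1) ^+ k * q ^+ 'C(k, 2) * q ^- (n * k)
    * qpoch q q n / qpoch q q m.
  by rewrite -qpoch_expVn mulfK.
have pow3 : q ^+ (3 * 'C(n, 2)) = q ^+ (2 * 'C(n, 2))
    * (q ^+ 'C(m, 2) * q ^+ 'C(k, 2) * q ^+ (m * k)).
  by rewrite -!exprD -bin2D -mulSnr.
rewrite /hahn_coef /euler_term /u /qpochs !big_cons !big_nil expVnE pow3.
have ab n' := qpoch_neq0 n' q0 hab; have ac n' := qpoch_neq0 n' q0 hac.
rewrite (exprMn _ _ (q ^+ k)) -(exprM q k) (mulnC k m).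
rewrite (exprMn _ (q ^+ n)) -(exprM q n) exprVn.
have -> : (- (a * t)) ^+ k = (-1) ^+ k * a ^+ k * t ^+ k.
  by rewrite -mulNr -mulN1r !exprMn.
rewrite !exprMn /n !(exprD t) !(exprD a) !(exprD b) !(exprD c).
by field; rewrite !qq !ab !ac !expf_neq0.
Qed.

Lemma hahn_coefE d k :
  qhyp_term [:: z / a; 1 / (a * z)] [:: 1 / (a * b); 1 / (a * c); d] q
    (- (a * t)) k = hahn_coef k / qpoch d q k.
Proof.
have -> : qhyp_term [:: z / a; 1 / (a * z)] [:: 1 / (a * b); 1 / (a * c); d] q
    (- (a * t)) k = qpochs [:: z / a; 1 / (a * z)] q k
    / qpochs [:: q; 1 / (a * b); 1 / (a * c); d] q k
    * ((-1) ^+ k * q ^+ 'C(k, 2)) ^+ 2 * (- (a * t)) ^+ k by [].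
rewrite /hahn_coef exprMn sign_sqr mul1r /qpochs !big_cons !big_nil !invfM.
by rewrite !mulrA !mulr1 invr1 !mulr1; ring.
Qed.

Lemma hahn_dominated d : (forall k, d != q ^- k) ->
  exists M, dominated (fun k => hahn_coef k / qpoch d q k) M.
Proof.
move=> hd.
have -> : (fun k => hahn_coef k / qpoch d q k) = qhyp_term
    [:: z / a; 1 / (a * z)] [:: 1 / (a * b); 1 / (a * c); d] q (- (a * t)).
  by apply/funext => k; rewrite hahn_coefE.
apply: (@qhyp_dominated _ _ _ _ _ 1) => // b' k.
by rewrite !inE => /or3P[] /eqP ->.
Qed.

(** The lower parameter 0 contributes (0;q)_k = 1. *)
Lemma hahn_coef_dominated : exists M, dominated hahn_coef M.
Proof.
have -> : hahn_coef = (fun k => hahn_coef k / qpoch 0 q k).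
  apply/funext => k; rewrite /qpoch big1 ?divr1 // => j _.
  by rewrite mul0r subr0.
by apply: hahn_dominated => k; rewrite eq_sym invr_eq0 expf_neq0.
Qed.

(** The partial sum runs over the triangle n < N, k <= n; summed by columns it
    becomes a sum over all k, the truncated difference N - k giving empty
    inner sums for k >= N.  It thus has the shape required by [tannery]. *)
Lemma partial_sum_generating N :
  series (fun n => t ^+ n * q ^+ (3 * 'C(n, 2)) * cdqinvHahn_z q n z a b c
      / qpochs [:: q; 1 / (a * b); 1 / (a * c)] q n) N
  = limn (series (fun k =>
      hahn_coef k * series (euler_term q (u * q ^+ k)) (N - k)%N)).
Proof.
rewrite (@series_finite_support R _ N) => [|k]; last first.
  rewrite -subn_eq0 => /eqP ->.
  by rewrite /series /= big_geq // mulr0.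
transitivity (\sum_(0 <= n < N) \sum_(0 <= k < n.+1)
    hahn_coef k * euler_term q (u * q ^+ k) (n - k)%N).
  apply: eq_bigr => n _; rewrite cdqinvHahn_zE !mulr_sumr mulr_suml.
  apply: eq_big_nat => k /andP[_ kn].
  by have := generating_summand (n - k) k; rewrite subnK.
rewrite (sum_antidiagonal (fun k m =>
  hahn_coef k * euler_term q (u * q ^+ k) m)).
by apply: eq_bigr => k _; rewrite -mulr_sumr.
Qed.

Lemma cvg_generating :
  series (fun n => t ^+ n * q ^+ (3 * 'C(n, 2)) * cdqinvHahn_z q n z a b c
      / qpochs [:: q; 1 / (a * b); 1 / (a * c)] q n) @ \oo
  --> limn (series (fun k => hahn_coef k * euler q (u * q ^+ k))).
Proof.
rewrite (funext partial_sum_generating).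
have [Ma aM] := hahn_coef_dominated.
have [Me eM] := euler_dominated q0 q1 u.
(* |E_(N-k)(u q^k)| is at most the sum of the majorant of E(u). *)
apply: (@tannery _ _ _ (limn (series Me) *: Ma)).
- move=> N; split=> [k|]; last by apply: is_cvg_seriesZ; case: aM.
  rewrite normrM mulrC rmorphM; apply: ler_pM; try exact: normr_ge0.
    by apply: dominated_series_le; exact: euler_dominated_scale.
  by case: aM.
- move=> k; apply: cvgM; first exact: cvg_cst.
  rewrite -(cvg_shiftn k); under eq_fun do rewrite addnK.
  exact: cvg_euler.
Qed.

End GeneratingFunction.

Theorem theorem6p16 (R : realType) (q z x a b c t : Cplx R)
    (hq0 : 0 < `|q|) (hq1 : `|q| < 1)
    (hz : z != 0) (hx : x = (z + z^-1) / 2) (hx0 : x != 0)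
    (ha : a != 0) (hb : b != 0) (hc : c != 0)
    (hab : forall k : nat, 1 / (a * b) != q ^- k)
    (hac : forall k : nat, 1 / (a * c) != q ^- k)
    (habct : forall k : nat, - (a * b * c * t) != q ^- k) :
  series (fun n : nat =>
      t ^+ n * q ^+ (3 * 'C(n, 2)) * cdqinvHahn q n x a b c
      / qpochs [:: q; 1 / (a * b); 1 / (a * c)] q n) @ \oo
  --> qpoch_inf (- (a * b * c * t)) q
      * qhyp [:: z / a; 1 / (a * z)]
             [:: 1 / (a * b); 1 / (a * c); - (a * b * c * t)] q (- (a * t)).
Proof.
have q0 : q != 0 by rewrite -normr_gt0.
rewrite hx; under [X in series X]eq_fun do rewrite cdqinvHahnE //.
set u := a * b * c * t.
pose h k := hahn_coef q z a b c t k / qpoch (- u) q k.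
have hE : qhyp_term [:: z / a; 1 / (a * z)]
    [:: 1 / (a * b); 1 / (a * c); - u] q (- (a * t)) = h.
  by apply/funext => k; rewrite hahn_coefE.
have [M hM] := hahn_dominated q0 hq1 z t hab hac habct.
have -> : qpoch_inf (- u) q * qhyp [:: z / a; 1 / (a * z)]
      [:: 1 / (a * b); 1 / (a * c); - u] q (- (a * t))
    = limn (series (fun k => hahn_coef q z a b c t k * euler q (u * q ^+ k))).
  rewrite /qhyp hE; transitivity (limn (series (qpoch_inf (- u) q *: h))).
    by symmetry; exact: lim_seriesZ (dominated_cvg hM).
  congr (limn (series _)); apply/funext => k.
  have -> : (qpoch_inf (- u) q *: h) k = qpoch_inf (- u) q * h k by [].
  by rewrite (qpoch_inf_split q0 hq1 u k) /h mulrC mulrA divfK // qpoch_neq0.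
exact: cvg_generating.
Qed.
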